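(* Let $G=(A\cup B,E)$ be a bipartite graph in which every node has a strict ranking of its neighbors, and let $G^*$ be the auxiliary instance defined below. If $S$ is a stable matching in $G^*$, then $S'$ is a popular max-matching in $G$.
   Context: Node $u$ prefers matching $M$ to $N$ if $u$ is matched in $M$ and unmatched in $N$, or matched in both and prefers its partner in $M$. $\phi(M,N)$ is the number of nodes preferring $M$ to $N$, $\Delta(M,N)=\phi(M,N)-\phi(N,M)$; a maximum matching $M$ of $G$ is a popular max-matching if $\Delta(M,N)\ge0$ for all maximum matchings $N$ of $G$. A matching $S$ in an instance with strict preferences is stable if no edge blocks it, where edge $(u,v)$ blocks $S$ if each of $u,v$ is unmatched in $S$ or prefers the other to its partner in $S$. The instance $G^*=(A^*\cup B^*,E^* )$: let $n_0=|A|$. $A^*=\{a_i: a\in A,\ 0\le i\le n_0-1\}$ ($n_0$ copies of each $a$). $B^*=\{\tilde b: b\in B\}\cup\{d_i(a): a\in A,\ 1\le i\le n_0-1\}$ (the $d_i(a)$ are dummy nodes). $E^*$ contains $(a_i,\tilde b)$ for every $(a,b)\in E$ and $0\le i\le n_0-1$, and $(a_{i-1},d_i(a))$, $(a_i,d_i(a))$ for every $a\in A$ and $1\le i\le n_0-1$. Preferences: if $a$'s ranking in $G$ is $b_1\succ\cdots\succ b_k$, then $a_0$ ranks $\tilde b_1\succ\cdots\succ\tilde b_k\succ d_1(a)$; for $1\le i\le n_0-2$, $a_i$ ranks $d_i(a)\succ\tilde b_1\succ\cdots\succ\tilde b_k\succ d_{i+1}(a)$; $a_{n_0-1}$ ranks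 $d_{n_0-1}(a)\succ\tilde b_1\succ\cdots\succ\tilde b_k$ (when $n_0=1$ there are no dummy nodes and $a_0$ ranks $\tilde b_1\succ\cdots\succ\tilde b_k$). Each $d_i(a)$ ranks $a_{i-1}\succ a_i$. Each $\tilde b$ ranks all its neighbors with subscript $n_0-1$ first, then all with subscript $n_0-2$, and so on, with all subscript-$0$ neighbors last; among neighbors with the same subscript $i$, $\tilde b$ prefers $z_i$ to $z'_i$ iff $b$ prefers $z$ to $z'$ in $G$. For a matching $S$ of $G^*$, $S'\subseteq E$ is obtained by deleting the edges of $S$ incident to dummy nodes and replacing each edge $(a_i,\tilde b)\in S$ by $(a,b)$. *)

(* Defs.v *)
From HB Require Import structures.
From mathcomp Require Import all_boot all_order all_algebra.

Set Implicit Arguments.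
Unset Strict Implicit.
Unset Printing Implicit Defensive.

(* The ranking of a node is the list of all its neighbors, best first. *)
Record instance (A B : finType) := Instance {
  edge : A -> B -> bool;
  rankA : A -> seq B;
  rankB : B -> seq A;
  rankA_uniq : forall a, uniq (rankA a);
  rankB_uniq : forall b, uniq (rankB b);
  mem_rankA : forall a b, (b \in rankA a) = edge a b;
  mem_rankB : forall b a, (a \in rankB b) = edge a b
}.

Section Matchings.

Variables (A B : finType) (G : instance A B).
Implicit Types (M N S : {set A * B}) (a : A) (b : B).

(* [betterA a b b'] is used only for neighbors [b], [b'] of [a]. *)
Definition betterA a b b' := index b (rankA G a) < index b' (rankA G a).
Definition betterB b a a' := index a (rankB G b) < index a' (rankB G b).

Definition matching M : Prop :=
  [/\ forall a b, (a, b) \in M -> edge G a b,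
      forall a b b', (a, b) \in M -> (a, b') \in M -> b = b'
    & forall a a' b, (a, b) \in M -> (a', b) \in M -> a = a'].

Definition max_matching M : Prop :=
  matching M /\ forall N, matching N -> #|N| <= #|M|.

Definition matchedA M a := [exists b, (a, b) \in M].
Definition matchedB M b := [exists a, (a, b) \in M].

Definition prefersA a M N :=
  (matchedA M a && ~~ matchedA N a)
  || [exists b, exists b', [&& (a, b) \in M, (a, b') \in N & betterA a b b']].
Definition prefersB b M N :=
  (matchedB M b && ~~ matchedB N b)
  || [exists a, exists a', [&& (a, b) \in M, (a', b) \in N & betterB b a a']].

Definition phi M N : nat :=
  #|[set a | prefersA a M N]| + #|[set b | prefersB b M N]|.

Definition Delta M N : int := ((phi M N)%:Z - (phi N M)%:Z)%R.

Definition popular_max_matching M : Prop :=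
  max_matching M /\ forall N, max_matching N -> (0 <= Delta M N)%R.

Definition blocks a b S :=
  [&& edge G a b,
      ~~ matchedA S a || [exists b', ((a, b') \in S) && betterA a b b']
    & ~~ matchedB S b || [exists a', ((a', b) \in S) && betterB b a a']].

Definition stable_matching S : Prop :=
  matching S /\ forall a b, ~~ blocks a b S.

End Matchings.

Section Star.

Variables (A B : finType) (G : instance A B).

Local Notation n0 := #|A|.

(* [(a, i)] is the copy a_i; [inl b] is b~; for j in {0, ..., n0 - 2},
   [inr (a, j)] is the dummy node d_{j+1}(a). *)
Definition starA : finType := (A * 'I_n0)%type.
Definition starB : finType := (B + A * 'I_(n0.-1))%type.

Definition star_edge (u : starA) (v : starB) : bool :=
  match v with
  | inl b => edge G u.1 b
  | inr (a, j) => (u.1 == a) && ((u.2 == j :> nat) || (u.2 == j.+1 :> nat))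
  end.

(* The two outer lists have at most one element: the first is [:: d_i(a)] if
   1 <= i and the last is [:: d_{i+1}(a)] if i <= n0 - 2. *)
Definition star_rankA (u : starA) : seq starB :=
  let: (a, i) := u in
  [seq inr (a, j) | j : 'I_(n0.-1) <- enum 'I_(n0.-1) & j.+1 == i :> nat]
  ++ [seq inl b | b <- rankA G a]
  ++ [seq inr (a, j) | j : 'I_(n0.-1) <- enum 'I_(n0.-1) & j == i :> nat].

Lemma dummy_hi_subproof (j : 'I_(n0.-1)) : j.+1 < n0.
Proof. by rewrite -ltn_predRL. Qed.

Definition dummy_lo (j : 'I_(n0.-1)) : 'I_n0 := widen_ord (leq_pred n0) j.
Definition dummy_hi (j : 'I_(n0.-1)) : 'I_n0 := Ordinal (dummy_hi_subproof j).

Definition star_rankB (v : starB) : seq starA :=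
  match v with
  | inl b => [seq (a, i) | i <- rev (enum 'I_n0), a <- rankB G b]
  | inr (a, j) => [:: (a, dummy_lo j); (a, dummy_hi j)]
  end.

Lemma star_rankA_uniq u : uniq (star_rankA u).
Proof.
case: u => a i; rewrite /star_rankA !cat_uniq.
have inrI : injective (fun j : 'I_(n0.-1) => inr (a, j) : starB).
  by move=> x y [].
have inlI : injective (inl : B -> starB) by move=> x y [].
rewrite !map_inj_uniq ?(filter_uniq _ (enum_uniq _)) ?rankA_uniq //= ?andbT.
apply/andP; split; apply/hasPn=> v.
- rewrite mem_cat => /orP[/mapP[b _ ->]|/mapP[j]].
    by apply/mapP=> -[].
  rewrite mem_filter => /andP[/eqP ji _] ->; apply/mapP=> -[k].
  by rewrite mem_filter => /andP[/eqP ki _] [jk]; move: ki; rewrite -jk -ji => /eqP;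
    rewrite eqn_leq ltnn.
- by move=> /mapP[j _ ->]; apply/mapP=> -[].
Qed.

Lemma star_rankB_uniq v : uniq (star_rankB v).
Proof.
case: v => [b|[a j]] /=.
  apply: allpairs_uniq; rewrite ?rev_uniq ?enum_uniq ?rankB_uniq //.
  by move=> [i x] [i' x'] _ _ [-> ->].
rewrite andbT inE xpair_eqE eqxx /= -val_eqE /=.
by rewrite eqn_leq ltnn andbF.
Qed.

Lemma mem_star_rankA u v : (v \in star_rankA u) = star_edge u v.
Proof.
case: u => a i; rewrite /star_rankA !mem_cat; case: v => [b|[a' j]] /=.
  rewrite (mem_map (fun x y (e : inl x = inl y :> starB) =>
    let: erefl := e in erefl)) mem_rankA.
  case: mapP => [[]//|_]; case: mapP => [[]//|_].
  by rewrite orbF.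
have inlN : (inr (a', j) \in [seq (inl b : starB) | b <- rankA G a]) = false.
  by apply/mapP=> -[].
rewrite inlN /=.
have mem_inr (P : pred 'I_(n0.-1)) :
  (inr (a', j) \in [seq (inr (a, k) : starB) | k <- enum 'I_(n0.-1) & P k])
  = (a == a') && P j.
  apply/mapP/andP => [[k]|[/eqP-> Pj]].
    by rewrite mem_filter => /andP[Pk _] [-> ->].
  by exists j; rewrite // mem_filter Pj mem_enum.
by rewrite !mem_inr -andb_orr orbC ![_ == val i]eq_sym.
Qed.

Lemma mem_star_rankB v u : (u \in star_rankB v) = star_edge u v.
Proof.
case: u => a i; case: v => [b|[a' j]] /=.
  rewrite -mem_rankB; apply/allpairsP/idP => [[[k x] /= [_ xb [-> _]]]//|ab].
  by exists (i, a); rewrite /= mem_rev mem_enum.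
by rewrite !inE !xpair_eqE -andb_orr -!val_eqE.
Qed.

Definition star : instance starA starB :=
  Instance star_rankA_uniq star_rankB_uniq mem_star_rankA mem_star_rankB.

End Star.

(* S' for a matching S of G*. *)
Definition project (A B : finType) (S : {set starA A * starB A B}) :
    {set A * B} :=
  [set e | [exists i, ((e.1, i), inl e.2) \in S]].

(* Main.v *)
(* In a stable matching S of G* every dummy node is matched, so each a in A has
   exactly one copy a_i that is not matched to a dummy node; let lev a := i and
   let lev b be the level of the partner of b in S' (0 if b is unmatched).
   Stability of S forces lev b >= lev a - 1 on every edge ab, unmatched nodes of A
   to have the top level n0 - 1, and the votes of a and b on the edge ab against
   their partners in S' to sum to at most 2 (lev b - lev a).  Summing over a maximum
   matching N, the levels telescope because |N| = |S'|, which gives popularity.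
   For maximality, either every non-isolated node of A is matched or two nodes
   have level n0 - 1; then some level is empty and cutting there yields a vertex
   cover of size |S'|. *)
Require Import Defs.
From mathcomp Require Import all_boot all_order all_algebra.
From mathcomp Require Import zify.

Set Implicit Arguments.
Unset Strict Implicit.
Unset Printing Implicit Defensive.

Import Order.TTheory GRing.Theory Num.Theory.

(** * Positions in concatenated and product lists *)

Lemma index_cat_lt (T : eqType) (s1 s2 : seq T) x y :
  x \in s1 -> y \notin s1 -> index x (s1 ++ s2) < index y (s1 ++ s2).
Proof.
move=> xs /negbTE ys; rewrite !index_cat xs ys.
by rewrite -index_mem in xs; apply: leq_trans xs (leq_addr _ _).
Qed.

Lemma index_cat_gt (T : eqType) (s1 s2 : seq T) x y :
  index x (s1 ++ s2) < index y (s1 ++ s2) -> y \in s1 -> x \in s1.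
Proof.
move=> lt_xy ys; apply: contraLR lt_xy => xs.
by rewrite -leqNgt ltnW // index_cat_lt.
Qed.

Lemma index_allpairs_swap (I T : eqType) (s : seq I) (t : seq T) i x :
    i \in s -> x \in t ->
  index (x, i) [seq (y, j) | j <- s, y <- t] = index i s * size t + index x t.
Proof.
move=> + xt; elim: s => //= j s IHs; rewrite inE index_cat => /predU1P ij.
have mem_ij : ((x, i) \in [seq (y, j) | y <- t]) = (j == i).
  by apply/mapP/eqP => [[y _ [_ ->]]|->] //; exists x.
rewrite mem_ij; case: eqVneq => [<-|ji].
  have pairI : injective (pair^~ j : T -> T * I) by move=> ? ? [].
  by rewrite -(index_map pairI t x).
case: ij => [eij|is_]; first by rewrite eij eqxx in ji.
by rewrite size_map IHs // mulSn addnA.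
Qed.

Lemma index_rev_enum_ord n (i : 'I_n) : index i (rev (enum 'I_n)) = n - i.+1.
Proof.
have lt_in := ltn_ord i.
have nth_i : nth i (rev (enum 'I_n)) (n - i.+1) = i.
  rewrite nth_rev size_enum_ord; last lia.
  by apply: val_inj; rewrite /= nth_enum_ord; lia.
rewrite -{1}nth_i index_uniq ?rev_uniq ?enum_uniq // size_rev size_enum_ord; lia.
Qed.

(** * Strict preferences, stability, and sums over a matching *)

Section Matchings.

Variables (A B : finType) (G : instance A B).

Lemma betterA_total a b b' : edge G a b -> edge G a b' ->
  [\/ b = b', betterA G a b b' | betterA G a b' b].
Proof.
rewrite -!mem_rankA /betterA => ab ab'.
case: (ltngtP (index b (rankA G a)) (index b' (rankA G a))) => [||eq_i].
- by constructor 2.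
- by constructor 3.
by constructor 1; rewrite -(nth_index b ab) eq_i nth_index.
Qed.

Lemma betterB_total b a a' : edge G a b -> edge G a' b ->
  [\/ a = a', betterB G b a a' | betterB G b a' a].
Proof.
rewrite -!mem_rankB /betterB => ab ab'.
case: (ltngtP (index a (rankB G b)) (index a' (rankB G b))) => [||eq_i].
- by constructor 2.
- by constructor 3.
by constructor 1; rewrite -(nth_index a ab) eq_i nth_index.
Qed.

(** If an edge does not block, one endpoint is matched and does not prefer the other end to its
    partner; strictness of its ranking makes that partner equal or strictly better. *)
Lemma stable_edge S a b : stable_matching G S -> edge G a b ->
  [\/ (a, b) \in S, exists2 b', (a, b') \in S & betterA G a b' b
    | exists2 a', (a', b) \in S & betterB G b a' a].
Proof.
move=> [[SE Sl Sr] stS] ab.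
have := stS a b; rewrite /blocks ab /= negb_and !negb_or.
case/orP=> /andP[/negPn/existsP[z zS] /existsPn nz]; move: {nz}(nz z); rewrite zS /= => nz.
  have [->|bb|] := betterA_total ab (SE _ _ zS); first by constructor 1.
    by rewrite bb in nz.
  by constructor 2; exists z.
have [->|bb|] := betterB_total ab (SE _ _ zS); first by constructor 1.
  by rewrite bb in nz.
by constructor 3; exists z.
Qed.

(** [fst] is injective on a matching. This turns sums over nodes, of levels in [nat] and of votes in
    [int], into sums over edges. *)
Lemma sum_matchedA (V : nmodType) M (F : A -> V) : matching G M ->
  (\sum_(a | matchedA M a) F a = \sum_(e in M) F e.1)%R.
Proof.
move=> [_ Ml _]; rewrite -(big_imset (h := fst) F) /=.
  apply: eq_bigl => a; apply/existsP/imsetP => [[b abM]|[[a' b] abM ->]].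
    by exists (a, b).
  by exists b.
by move=> [a b] [a' b'] /= e e' eaa; rewrite -eaa in e' *; rewrite (Ml _ _ _ e e').
Qed.

Lemma sum_matchedB (V : nmodType) M (F : B -> V) : matching G M ->
  (\sum_(b | matchedB M b) F b = \sum_(e in M) F e.2)%R.
Proof.
move=> [_ _ Mr]; rewrite -(big_imset (h := snd) F) /=.
  apply: eq_bigl => b; apply/existsP/imsetP => [[a abM]|[[a b'] abM ->]].
    by exists (a, b).
  by exists a.
by move=> [a b] [a' b'] /= e e' ebb; rewrite -ebb in e' *; rewrite (Mr _ _ _ e e').
Qed.

(* The certificate of popularity and maximality of M read off a stable matching
   of the auxiliary instance: [lev a] is the subscript of the only copy of [a]
   that is not matched to a dummy node. *)
Definition leveled (M : {set A * B}) (lev : A -> nat) : Prop :=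
  [/\ forall a, lev a < #|A|,
      forall a, ~~ matchedA M a -> lev a = #|A|.-1,
      forall a b, edge G a b ->
        [\/ (a, b) \in M, exists2 b', (a, b') \in M & betterA G a b' b
          | exists2 a', (a', b) \in M &
              lev a < lev a' \/ lev a = lev a' /\ betterB G b a' a]
    & forall a b, edge G a b -> 0 < lev a ->
        exists2 a', (a', b) \in M &
          lev a <= lev a' \/ lev a = (lev a').+1 /\ betterB G b a' a].

(** * Maximality of a leveled matching *)

Variables (M : {set A * B}) (lev : A -> nat).
Hypotheses (MM : matching G M) (levM : leveled M lev).

(** The hypothesis describes a vertex cover: matched nodes of [A] below level [k], and nodes of [B]
    whose partner has level at least [k]. Each edge of [M] has exactly one end in it, so it has size
    [#|M|], which bounds every matching. *)
Lemma leveled_cover_max k :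
    (forall a b, edge G a b ->
       matchedA M a && (lev a < k) \/ exists2 a', (a', b) \in M & k <= lev a') ->
  max_matching G M.
Proof.
move=> cov; split=> // N [NE Nl Nr]; have [_ Ml Mr] := MM.
pose M1 := [set e in M | lev e.1 < k]; pose M2 := [set e in M | k <= lev e.1].
pose N1 := [set e in N | e.1 \in fst @: M1]; pose N2 := [set e in N | e.2 \in snd @: M2].
have leN1 : #|N1| <= #|M1|.
  apply: leq_trans (leq_imset_card fst M1).
  rewrite -(card_in_imset (f := fst) (D := mem N1)).
    by apply/subset_leq_card/subsetP => _ /imsetP[e + ->]; rewrite inE => /andP[].
  move=> [a b] [a' b'] /= /setIdP[e _] /setIdP[e' _] /= eaa.
  by rewrite -eaa in e' *; rewrite (Nl _ _ _ e e').
have leN2 : #|N2| <= #|M2|.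
  apply: leq_trans (leq_imset_card snd M2).
  rewrite -(card_in_imset (f := snd) (D := mem N2)).
    by apply/subset_leq_card/subsetP => _ /imsetP[e + ->]; rewrite inE => /andP[].
  move=> [a b] [a' b'] /= /setIdP[e _] /setIdP[e' _] /= ebb.
  by rewrite -ebb in e' *; rewrite (Nr _ _ _ e e').
have leN : #|N| <= #|N1| + #|N2|.
  apply: leq_trans (leq_card_setU N1 N2).
  apply/subset_leq_card/subsetP => -[a b] abN; rewrite !inE abN /=.
  have [/andP[/existsP[b' ab'M] lt_k]|[a' a'bM le_k]] := cov a b (NE _ _ abN).
    by apply/orP; left; apply/imsetP; exists (a, b'); rewrite // inE ab'M.
  by apply/orP; right; apply/imsetP; exists (a', b); rewrite // inE a'bM.
have <- : #|M1| + #|M2| = #|M|.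
  rewrite -(cardsID [set e | lev e.1 < k] M).
  by congr (_ + _); apply: eq_card => e; rewrite !inE // -leqNgt andbC.
by apply: leq_trans leN (leq_add leN1 leN2).
Qed.

(* If some unmatched node has a neighbor then two nodes share the top level, so
   some level k is empty; the nodes of A below k and the nodes of B matched above
   k form a vertex cover that uses one endpoint of every edge of M. *)
Lemma leveled_max : max_matching G M.
Proof.
have [lev_lt lev_free near dom] := levM.
have [|] := boolP [forall a, forall b, edge G a b ==> matchedA M a].
  (* With threshold [#|A|] all levels are below it, so the cover is the set of matched nodes of
     [A]. *)
  move=> /forallP allM; apply: (leveled_cover_max (k := #|A|)) => a b ab; left.
  by rewrite lev_lt andbT; move/forallP/(_ b)/implyP: (allM a); apply.
case/forallPn=> a /forallPn[b]; rewrite negb_imply => /andP[ab aM].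
have la := lev_free a aM.
have [a' a'bM la'] : exists2 a', (a', b) \in M & lev a' = lev a.
  have aNM b' : (a, b') \notin M by move/existsPn: aM.
  have [abM|[b' ab'M _]|[a' a'bM H]] := near a b ab.
  - by rewrite (negPf (aNM b)) in abM.
  - by rewrite (negPf (aNM b')) in ab'M.
  by exists a' => //; have := lev_lt a'; lia.
have neq_a : a != a' by apply: contraNneq aM => ->; apply/existsP; exists b.
pose f x := Ordinal (lev_lt x).
have [k kf] : exists k : 'I_#|A|, k \notin codom f.
  (* If every level occurred, [f] would map [A] onto a set of the same size and so be injective, yet
     it identifies [a] and [a']. *)
  apply/existsP; rewrite -negb_forall; apply/negP => /forallP onto_f.
  have : injective f.
    by apply/injectiveP; rewrite /injectiveb /dinjectiveb; apply/card_uniqP;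
       rewrite size_map -cardE (eq_card (B := 'I_#|A|)) ?card_ord.
  have faa' : f a = f a' by apply: val_inj; rewrite /= la'.
  by move/(_ a a' faa') => eaa; rewrite eaa eqxx in neq_a.
have lev_k x : lev x != k.
  by apply: contraNneq kf => lx; apply/codomP; exists x; apply: val_inj.
apply: (leveled_cover_max (k := k)) => x y xy; have lt_k := ltn_ord k.
have := lev_k x; case: ltngtP => // [lt_xk|gt_xk] _.
  left; rewrite andbT; apply: contraLR lt_xk => /lev_free ->; lia.
(* [dom] loses at most one level, and [lev x] is above [k]. *)
right; have [x' x'yM H] := dom x y xy (leq_ltn_trans (leq0n k) gt_xk).
by exists x' => //; have := lev_k x'; lia.
Qed.

(** * Votes, and popularity of a leveled matching *)

Lemma prefersA_asym N a : matching G N ->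
  prefersA G a M N -> ~~ prefersA G a N M.
Proof.
case: MM => _ Ml _ [_ Nl _] pMN; apply/negP.
case/orP: pMN => [/andP[/existsP[b abM] aN]|/existsP[b /existsP[b' /and3P[abM ab'N lt_bb']]]].
  case/orP=> [/andP[aN' _]|/existsP[c /existsP[c' /and3P[acN _ _]]]].
    by rewrite aN' in aN.
  by case/negP: aN; apply/existsP; exists c.
case/orP=> [/andP[_ /negP[]]|/existsP[c /existsP[c' /and3P[acN acM]]]].
  by apply/existsP; exists b.
by rewrite (Nl _ _ _ acN ab'N) (Ml _ _ _ acM abM) /betterA ltnNge ltnW.
Qed.

Lemma prefersB_asym N b : matching G N ->
  prefersB G b M N -> ~~ prefersB G b N M.
Proof.
case: MM => _ _ Mr [_ _ Nr] pMN; apply/negP.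
case/orP: pMN => [/andP[/existsP[a abM] bN]|/existsP[a /existsP[a' /and3P[abM ab'N lt_bb']]]].
  case/orP=> [/andP[bN' _]|/existsP[c /existsP[c' /and3P[acN _ _]]]].
    by rewrite bN' in bN.
  by case/negP: bN; apply/existsP; exists c.
case/orP=> [/andP[_ /negP[]]|/existsP[c /existsP[c' /and3P[acN acM]]]].
  by apply/existsP; exists a.
by rewrite (Nr _ _ _ acN ab'N) (Mr _ _ _ acM abM) /betterB ltnNge ltnW.
Qed.

(** The sign is positive for [N], so popularity of [M] means that the total vote is at most 0. *)
Definition voteA N a : int := ((prefersA G a N M)%:Z - (prefersA G a M N)%:Z)%R.
Definition voteB N b : int := ((prefersB G b N M)%:Z - (prefersB G b M N)%:Z)%R.

Lemma DeltaE N :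
  Delta G M N = (- (\sum_a voteA N a + \sum_b voteB N b))%R.
Proof.
have cardE_sum (T : finType) (P : pred T) : (#|[set x | P x]|%:Z = \sum_x (P x)%:Z)%R.
  rewrite cardsE -sum1_card big_mkcond (big_morph Posz PoszD (erefl _)) /=.
  by apply: eq_bigr => x _; rewrite unfold_in; case: (P x).
rewrite /Delta /phi !PoszD !cardE_sum /voteA /voteB !sumrB.
by rewrite [RHS]opprD !opprB [RHS]addrACA -opprD.
Qed.

Lemma voteA_unmatched N a : ~~ matchedA N a -> (voteA N a <= 0)%R.
Proof.
move=> aN; suff : prefersA G a N M = false by rewrite /voteA => ->; lia.
apply/negbTE/negP => /orP[/andP[aN' _]|/existsP[c /existsP[c' /and3P[acN _ _]]]].
  by rewrite aN' in aN.
by case/negP: aN; apply/existsP; exists c.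
Qed.

Lemma voteB_unmatched N b : ~~ matchedB N b -> (voteB N b <= 0)%R.
Proof.
move=> bN; suff : prefersB G b N M = false by rewrite /voteB => ->; lia.
apply/negbTE/negP => /orP[/andP[bN' _]|/existsP[c /existsP[c' /and3P[acN _ _]]]].
  by rewrite bN' in bN.
by case/negP: bN; apply/existsP; exists c.
Qed.

Lemma voteA_worse N a b b' : matching G N ->
  (a, b) \in N -> (a, b') \in M -> betterA G a b' b -> voteA N a = (-1)%R.
Proof.
move=> NM abN ab'M lt_b; have pMN : prefersA G a M N.
  by apply/orP; right; apply/existsP; exists b'; apply/existsP; exists b; apply/and3P.
by rewrite /voteA pMN (negPf (prefersA_asym NM pMN)).
Qed.

Lemma voteB_worse N b a a' : matching G N ->
  (a, b) \in N -> (a', b) \in M -> betterB G b a' a -> voteB N b = (-1)%R.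
Proof.
move=> NM abN a'bM lt_a; have pMN : prefersB G b M N.
  by apply/orP; right; apply/existsP; exists a'; apply/existsP; exists a; apply/and3P.
by rewrite /voteB pMN (negPf (prefersB_asym NM pMN)).
Qed.

(** At most one term occurs, as [M] is a matching; an unmatched [b] gets the default level 0. *)
Definition levB b : nat := \sum_(a | (a, b) \in M) lev a.

Lemma levBE a b : (a, b) \in M -> levB b = lev a.
Proof.
case: MM => _ _ Mr abM; rewrite /levB (bigD1 a) //= big1 ?addn0 // => a' /andP[a'bM].
by rewrite (Mr _ _ _ a'bM abM) eqxx.
Qed.

(** Two votes sum to at most 2, so a rise of one level from [a] to [b] suffices. On equal levels
    either the edge is in [M] or one endpoint votes for [M]. A drop is by exactly one level, and
    then both endpoints vote for [M]. *)
Lemma vote_edge N a b : matching G N -> (a, b) \in N ->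
  (voteA N a + voteB N b <= 2 * ((levB b)%:Z - (lev a)%:Z))%R.
Proof.
move=> NM abN; have ab : edge G a b by case: NM => + _ _; apply.
have [_ _ near dom] := levM; have [ME Ml Mr] := MM.
have vA1 : (voteA N a <= 1)%R by rewrite /voteA ; lia.
have vB1 : (voteB N b <= 1)%R by rewrite /voteB ; lia.
have [abM|[b' ab'M lt_b]|[a' a'bM H]] := near a b ab.
- rewrite (levBE abM); have [NE Nl Nr] := NM.
  have pA : prefersA G a N M = false.
    apply/negbTE/negP => /orP[/andP[_ /negP[]]|/existsP[c /existsP[c' /and3P[acN acM]]]].
      by apply/existsP; exists b.
    by rewrite (Nl _ _ _ acN abN) (Ml _ _ _ acM abM) /betterA ltnn.
  have pB : prefersB G b N M = false.
    apply/negbTE/negP => /orP[/andP[_ /negP[]]|/existsP[c /existsP[c' /and3P[acN acM]]]].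
      by apply/existsP; exists a.
    by rewrite (Nr _ _ _ acN abN) (Mr _ _ _ acM abM) /betterB ltnn.
  rewrite /voteA /voteB pA pB; lia.
- have vA := voteA_worse NM abN ab'M lt_b.
  (* At level 0 the bound is nonnegative, even for [b] unmatched in [M]; at higher levels [dom]
     makes [b] matched. *)
  have [la|] := posnP (lev a); first lia.
  case/(dom _ _ ab) => a' a'bM; rewrite (levBE a'bM) => -[|[la lt_a]]; first lia.
  have := voteB_worse NM abN a'bM lt_a; lia.
- rewrite (levBE a'bM); case: H => [|[la lt_a]]; first lia.
  have := voteB_worse NM abN a'bM lt_a; lia.
Qed.

(** Nodes of [B] that [M] misses have level 0, so matching them adds nothing to the left-hand
    sum. *)
Lemma sum_levB N : matching G N ->
  \sum_(e in N) levB e.2 <= \sum_(e in M) lev e.1.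
Proof.
move=> NM; rewrite -(sum_matchedB levB NM).
have -> : \sum_(e in M) lev e.1 = \sum_(e in M) levB e.2.
  by apply: eq_bigr => -[a b] abM; rewrite /= (levBE abM).
rewrite -(sum_matchedB levB MM) [X in _ <= X]big_mkcond [X in X <= _]big_mkcond /=.
apply: leq_sum => b _; case: ifP => // _; case: ifP => // /negbT/existsPn bM.
by rewrite /levB big_pred0 // => a; apply/negbTE/bM.
Qed.

(* The complement #|A|.-1 - lev vanishes outside M, and |M| = |N|. *)
Lemma sum_lev N : matching G N -> #|N| = #|M| ->
  \sum_(e in M) lev e.1 <= \sum_(e in N) lev e.1.
Proof.
move=> NM cardN; have [lev_lt lev_free _ _] := levM.
pose c a := #|A|.-1 - lev a.
have sumc (X : {set A * B}) :
    \sum_(e in X) lev e.1 + \sum_(e in X) c e.1 = #|X| * #|A|.-1.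
  rewrite -big_split -sum_nat_const /=; apply: eq_bigr => e _.
  by apply: subnKC; have := lev_lt e.1; case: #|A|.
have : \sum_(e in N) c e.1 <= \sum_(e in M) c e.1.
  rewrite -(sum_matchedA c NM) -(sum_matchedA c MM).
  rewrite [X in _ <= X]big_mkcond [X in X <= _]big_mkcond /=.
  apply: leq_sum => a _; case: ifP => // _; case: ifP => // /negbT/lev_free.
  by rewrite /c => ->; rewrite subnn.
have := sumc M; have := sumc N; rewrite cardN; lia.
Qed.

Lemma leveled_popular : popular_max_matching G M.
Proof.
have [_ maxM] := leveled_max; split=> [|N [NM maxN]]; first exact: leveled_max.
have cardN : #|N| = #|M| by apply/eqP; rewrite eqn_leq maxM // maxN.
have leA : (\sum_a voteA N a <= \sum_(e in N) voteA N e.1)%R.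
  rewrite -(sum_matchedA (voteA N) NM) [X in (_ <= X)%R]big_mkcond /=.
  by apply: ler_sum => a _; case: ifP => // /negbT/voteA_unmatched.
have leB : (\sum_b voteB N b <= \sum_(e in N) voteB N e.2)%R.
  rewrite -(sum_matchedB (voteB N) NM) [X in (_ <= X)%R]big_mkcond /=.
  by apply: ler_sum => b _; case: ifP => // /negbT/voteB_unmatched.
have leN : (\sum_(e in N) voteA N e.1 + \sum_(e in N) voteB N e.2 <=
    2 * ((\sum_(e in N) levB e.2)%N%:Z - (\sum_(e in N) lev e.1)%N%:Z))%R.
  rewrite -big_split /= !(big_morph Posz PoszD (erefl _)) -sumrB mulr_sumr.
  by apply: ler_sum => -[a b] abN; apply: vote_edge.
(* Chained through the level sum over [M], these two inequalities make the bound of [leN] at most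
   0. *)
have := sum_levB NM; have := sum_lev NM cardN; rewrite DeltaE; lia.
Qed.

End Matchings.

(** * Rankings in the auxiliary instance *)

Section Star.

Variables (A B : finType) (G : instance A B).

Local Notation n0 := #|A|.
Local Notation sA := (starA A).
Local Notation sB := (starB A B).

Lemma star_betterA_inl (a : A) (i : 'I_n0) b b' : edge G a b -> edge G a b' ->
  betterA (star G) (a, i) (inl b) (inl b') = betterA G a b b'.
Proof.
rewrite -!mem_rankA /betterA /= /star_rankA => ab ab'.
set s := map _ (filter _ _).
have sN c : inl c \in s = false by apply/mapP => -[].
have inlI : injective (inl : B -> sB) by move=> x y [].
by rewrite !index_cat !sN ltn_add2l !(mem_map inlI) ab ab' !(index_map inlI).
Qed.

(** If [j.+1 = i], the dummy node is the only member of the first block of the ranking, so nothing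
    precedes it. *)
Lemma star_betterA_inr (a : A) (i : 'I_n0) v (j : 'I_n0.-1) :
  betterA (star G) (a, i) v (inr (a, j)) -> j.+1 <> i.
Proof.
move=> + ji; rewrite /betterA /= /star_rankA => lt_v.
have mem_j : inr (a, j) \in [seq (inr (a, k) : sB) | k : 'I_n0.-1 <- enum 'I_n0.-1 & k.+1 == i :> nat].
  by apply/mapP; exists j; rewrite // mem_filter mem_enum ji eqxx.
have /mapP[k] := index_cat_gt lt_v mem_j.
rewrite mem_filter => /andP[/eqP ki _] v_k; move: lt_v; rewrite v_k.
have -> : k = j by apply: ord_inj; apply: succn_inj; rewrite ki ji.
by rewrite ltnn.
Qed.

Lemma star_betterA_dummy (a : A) (i : 'I_n0) b (j : 'I_n0.-1) : edge G a b ->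
  betterA (star G) (a, i) (inr (a, j)) (inl b) -> j.+1 = i.
Proof.
move=> ab; rewrite /betterA /= /star_rankA catA => lt_jb.
have /(index_cat_gt lt_jb) : inl b \in
    [seq (inr (a, k) : sB) | k : 'I_n0.-1 <- enum 'I_n0.-1 & k.+1 == i :> nat]
    ++ [seq inl c | c <- rankA G a].
  by rewrite mem_cat; apply/orP; right; apply/map_f; rewrite mem_rankA.
rewrite mem_cat => /orP[/mapP[k]|/mapP[]//].
by rewrite mem_filter => /andP[/eqP <- _] [->].
Qed.

(** A position in [star_rankB (inl b)] is a two-digit number in base [size (rankB G b)]: the
    reversed subscript, then the rank in [G]. The comparison is thus lexicographic. *)
Lemma star_betterB_inl b (u u' : sA) : edge G u.1 b -> edge G u'.1 b ->
  betterB (star G) (inl b) u u' -> u'.2 < u.2 \/ u'.2 = u.2 /\ betterB G b u.1 u'.1.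
Proof.
case: u u' => [a i] [a' i'] /= ab a'b; rewrite /betterB /= /star_rankB.
rewrite !index_allpairs_swap ?mem_rev ?mem_enum ?mem_rankB //.
rewrite !index_rev_enum_ord.
have := ltn_ord i; have := ltn_ord i'.
rewrite -mem_rankB -index_mem in ab; rewrite -mem_rankB -index_mem in a'b.
case: (ltngtP i' i) => [|lt_ii'|/ord_inj ->]; first by left.
  move=> lt1 lt2; rewrite ltnNge => /negP[].
  have -> : n0 - i.+1 = (n0 - i'.+1) + (i' - i) by lia.
  rewrite mulnDl -addnA leq_add2l.
  apply: leq_trans (ltnW a'b) (leq_trans _ (leq_addr _ _)).
  by rewrite leq_pmull // subn_gt0.
by move=> _ _; rewrite ltn_add2l; right.
Qed.

Lemma star_betterB_inr (a : A) (j : 'I_n0.-1) (u u' : sA) :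
  betterB (star G) (inr (a, j)) u u' -> u'.1 = a -> u'.2 <> j :> nat.
Proof.
case: u' => x' i' /= lt_u x'a i'j; move: lt_u; rewrite x'a /betterB /=.
have -> : i' = dummy_lo j by apply: val_inj; rewrite /= i'j.
by rewrite eqxx ltn0.
Qed.

Lemma dummy_loE (j : 'I_n0.-1) : dummy_lo j = j :> nat. Proof. by []. Qed.

Lemma dummy_hiE (j : 'I_n0.-1) : dummy_hi j = j.+1 :> nat. Proof. by []. Qed.

(** * Dummy nodes under a stable matching *)

Variable S : {set sA * sB}.
Hypothesis stS : stable_matching (star G) S.

Let SE (u : sA) (v : sB) : (u, v) \in S -> star_edge G u v.
Proof. by case: stS => -[H _ _] _; apply: H. Qed.

Let Sl (u : sA) (v v' : sB) : (u, v) \in S -> (u, v') \in S -> v = v'.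
Proof. by case: stS => -[_ H _] _; apply: H. Qed.

Let Sr (u u' : sA) (v : sB) : (u, v) \in S -> (u', v) \in S -> u = u'.
Proof. by case: stS => -[_ _ H] _; apply: H. Qed.

(* a_{j+1} ranks d_{j+1}(a), i.e. [inr (a, j)], first. *)
Lemma dummy_matched (a : A) (j : 'I_n0.-1) :
  ((a, dummy_lo j), inr (a, j)) \in S \/ ((a, dummy_hi j), inr (a, j)) \in S.
Proof.
have e : edge (star G) (a, dummy_hi j) (inr (a, j)) by rewrite /= !eqxx orbT.
have [|[v _ /star_betterA_inr]|[[x i] xS _]] := stable_edge stS e; first by right.
  by [].
have /= /andP[/eqP xa] := SE xS; rewrite {}xa in xS.
case/orP=> /eqP ij; [left | right].
  by have -> : dummy_lo j = i by apply: val_inj.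
by have -> : dummy_hi j = i by apply: val_inj.
Qed.

Definition dummy_free (a : A) (i : 'I_n0) := [forall j, ((a, i), inr (a, j)) \notin S].

Lemma dummy_partner (a x : A) (i : 'I_n0) (j : 'I_n0.-1) :
  ((a, i), inr (x, j)) \in S -> x = a /\ (i = j :> nat \/ i = j.+1 :> nat).
Proof. by move/SE => /= /andP[/eqP-> /orP[]/eqP]; auto. Qed.

(** Otherwise the copy with subscript 0 takes [inr (a, 0)], which forces subscript 1 to take
    [inr (a, 1)], and so on; the last copy is left without a dummy node. *)
Lemma exists_dummy_free (a : A) : exists i, dummy_free a i.
Proof.
apply/existsP; rewrite -[[exists _, _]]negbK negb_exists; apply/negP => /forallP nofree.
have partner i : exists j : 'I_n0.-1, ((a, i), inr (a, j)) \in S.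
  by have /forallPn[j] := nofree i; rewrite negbK; exists j.
have low (k : nat) (i : 'I_n0) (j : 'I_n0.-1) :
    i = k :> nat -> ((a, i), inr (a, j)) \in S -> j = k :> nat.
  elim: k i j => [|k IHk] i j ik ijS; have [_ ij] := dummy_partner ijS; first lia.
  have lt_k : k < n0 by have := ltn_ord i; lia.
  have [j' j'S] := partner (Ordinal lt_k).
  have j'k := IHk (Ordinal lt_k) j' erefl j'S.
  case: ij => ij; first lia.
  have jj' : j = j' by apply: ord_inj; lia.
  rewrite jj' in ijS; have ik' : i = k :> nat by have [->] := Sr ijS j'S.
  lia.
have n0_gt0 : 0 < n0 by apply/card_gt0P; exists a.
have lt_n : n0.-1 < n0 by lia.
have [j jS] := partner (Ordinal lt_n).
have jn : j = n0.-1 :> nat by apply: low jS.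
by have := ltn_ord j; rewrite jn ltnn.
Qed.

(** The dummy node just under the free copy [i] must go to copy [i - 1]; this copy is then lost to
    the next dummy node down, which goes to copy [i - 2], and so on. The induction is on the
    distance to [i]. *)
Lemma dummy_below (a : A) (i k : 'I_n0) (j : 'I_n0.-1) :
  dummy_free a i -> k < i -> j = k :> nat -> ((a, k), inr (a, j)) \in S.
Proof.
move=> /forallP free lt_ki; have [m im] : exists m, i = k + m.+1 :> nat.
  by exists (i - k).-1; lia.
elim: m k j im {lt_ki} => [|m IHm] k j im jk; have lt_i := ltn_ord i.
  have [|hiS] := dummy_matched a j.
    by have -> : dummy_lo j = k by apply: val_inj.
  have hi_i : dummy_hi j = i by apply: ord_inj; rewrite dummy_hiE; lia.
  by have := free j; rewrite -hi_i hiS.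
have [|hiS] := dummy_matched a j.
  by have -> : dummy_lo j = k by apply: val_inj.
have lt_j' : j.+1 < n0.-1 by lia.
have j'S : ((a, dummy_hi j), inr (a, Ordinal lt_j')) \in S.
  by apply: IHm; rewrite dummy_hiE //; lia.
have jj' : j = j.+1 :> nat by have [{1}->] := Sl hiS j'S.
lia.
Qed.

Lemma dummy_above (a : A) (i k : 'I_n0) (j : 'I_n0.-1) :
  dummy_free a i -> i < k -> k = j.+1 :> nat -> ((a, k), inr (a, j)) \in S.
Proof.
move=> /forallP free lt_ik; have [m km] : exists m, k = i + m.+1 :> nat.
  by exists (k - i).-1; lia.
elim: m k j km {lt_ik} => [|m IHm] k j km kj.
  have [loS|] := dummy_matched a j.
    have lo_i : dummy_lo j = i by apply: ord_inj; rewrite dummy_loE; lia.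
    by have := free j; rewrite -lo_i loS.
  by have -> : dummy_hi j = k by apply: val_inj.
have [loS|] := dummy_matched a j; last first.
  by have -> : dummy_hi j = k by apply: val_inj.
have lt_j' : j.-1 < n0.-1 by have := ltn_ord j; lia.
have j'S : ((a, dummy_lo j), inr (a, Ordinal lt_j')) \in S.
  by apply: IHm; rewrite dummy_loE; [lia | apply/esym/prednK; lia].
have jj' : j = j.-1 :> nat by have [{1}->] := Sl loS j'S.
lia.
Qed.

(** The chains below and above [i] tie every other copy to a dummy node. Hence the level of [a] is
    well defined. *)
Lemma dummy_free_inl (a : A) (i k : 'I_n0) b :
  dummy_free a i -> ((a, k), inl b) \in S -> k = i.
Proof.
move=> free kbS; apply: ord_inj; have lt_i := ltn_ord i; have lt_k := ltn_ord k.
case: (ltngtP k i) => // [lt_ki|lt_ik].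
  have lt_j : k < n0.-1 by lia.
  by have := Sl kbS (dummy_below free lt_ki (erefl : Ordinal lt_j = k :> nat)).
have lt_j : k.-1 < n0.-1 by lia.
have jk : k = (Ordinal lt_j).+1 :> nat by apply/esym/prednK; lia.
by have := Sl kbS (dummy_above free lt_ik jk).
Qed.

(** * The projected matching and its levels *)

Lemma project_matching : matching G (project S).
Proof.
split=> [a b|a b b'|a a' b]; rewrite !inE /=.
- by case/existsP=> i /SE.
- case/existsP=> i iS; case/existsP=> i' i'S.
  have [k free] := exists_dummy_free a.
  have ei := dummy_free_inl free iS; have ei' := dummy_free_inl free i'S.
  rewrite {}ei in iS; rewrite {}ei' in i'S.
  by have [] := Sl iS i'S.
- by case/existsP=> i iS; case/existsP=> i' i'S; have [] := Sr iS i'S.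
Qed.

(** The level is the subscript of the dummy-free copy. Stability is applied to three edges: from
    that copy to the dummy node above it, from that copy to [inl b], and from the copy one below to
    [inl b]. *)
Lemma project_leveled : exists lev : A -> nat, leveled G (project S) lev.
Proof.
have [lev free] := fin_all_exists exists_dummy_free.
have levS a i b : ((a, i), inl b) \in S -> i = lev a by apply: dummy_free_inl.
have inP a i b : ((a, i), inl b) \in S -> (a, b) \in project S.
  by move=> iS; rewrite inE; apply/existsP; exists i.
exists lev; split=> [a|a aM|a b ab|a b ab lev_gt0]; have lt_lev := ltn_ord (lev a).
- by [].
(* Below the top level, [inr (a, lev a)] has the free copy as first choice, so that copy must be
   matched, and not to a dummy node. *)
- apply/eqP; apply: contraNT aM => lev_n.
  have lt_j : lev a < n0.-1 by lia.
  pose j := Ordinal lt_j.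
  have e : edge (star G) (a, lev a) (inr (a, j)) by rewrite /= !eqxx.
  have [eS|[v vS _]|[u uS /star_betterB_inr H]] := stable_edge stS e.
  + by have /forallP/(_ j) := free a; rewrite eS.
  + case: v vS => [b /inP abM|[x j'] vS]; first by apply/existsP; exists b.
    have [xa _] := dummy_partner vS; rewrite {}xa in vS.
    by have /forallP/(_ j') := free a; rewrite vS.
  + by case: H.
- have [eS|[v vS lt_v]|[[x i] uS lt_u]] :=
    stable_edge stS (ab : edge (star G) (a, lev a) (inl b)).
  + by constructor 1; apply: inP eS.
  + constructor 2; case: v vS lt_v => [b' vS|[x j] vS _].
      by rewrite (star_betterA_inl _ (SE vS) ab) => lt_b; exists b' => //; apply: inP vS.
    have [xa _] := dummy_partner vS; rewrite {}xa in vS.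
    by have /forallP/(_ j) := free a; rewrite vS.
  + constructor 3; exists x; first exact: inP uS.
    have := star_betterB_inl (SE uS : edge G (x, i).1 b) (ab : edge G (a, lev a).1 b) lt_u.
    by rewrite /= (levS _ _ _ uS) => -[|[-> ?]]; auto.
(* The copy one below the free one is matched to its last choice, so [inl b] must prefer its own
   partner to that copy; this compares levels with [lev a - 1]. *)
- have lt_k : (lev a).-1 < n0 by lia.
  have lt_j : (lev a).-1 < n0.-1 by lia.
  have kS : ((a, Ordinal lt_k), inr (a, Ordinal lt_j)) \in S.
    by apply: dummy_below (free a) _ _ => //; rewrite ltn_predL.
  have [eS|[v vS]|[[x i] uS lt_u]] :=
    stable_edge stS (ab : edge (star G) (a, Ordinal lt_k) (inl b)).
  + by have := Sl eS kS.
  + rewrite (Sl vS kS) => /(star_betterA_dummy ab) /eqP.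
    by rewrite eqn_leq ltnn.
  + exists x; first exact: inP uS.
    have := star_betterB_inl (SE uS : edge G (x, i).1 b)
      (ab : edge G (a, Ordinal lt_k).1 b) lt_u.
    rewrite -(levS _ _ _ uS) => -[lt_i|[ki lt_x]]; [left | right].
      by rewrite -(prednK lev_gt0).
    by split=> //; rewrite -[i]/((x, i).2) -ki; apply/esym/prednK.
Qed.

End Star.

Theorem theorem3 (A B : finType) (G : instance A B)
    (S : {set starA A * starB A B}) :
  stable_matching (star G) S -> popular_max_matching G (project S).
Proof.
move=> stS; have [lev levM] := project_leveled stS.
exact: leveled_popular (project_matching stS) levM.
Qed.
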